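(* Let $d\in\{4,5\}$ and let $A\subseteq \mathbb S^{d-1}$ be a measurable zero-sum-free set. Then $\sigma_{d-1}(A)\le \frac{71}{120}$.
   Context: $\mathbb S^{d-1}$ is the unit sphere in $\mathbb R^d$, and $\sigma_{d-1}$ is its rotation-invariant (surface) probability measure. A measurable set $A\subseteq\mathbb S^{d-1}$ is called zero-sum-free if there are no $x,y,z\in A$ with $x+y+z=0$ (sum in $\mathbb R^d$). *)

(* Defs.v *)
From mathcomp Require Import all_boot all_order all_algebra.
From mathcomp Require Import all_classical all_reals all_analysis.
Import Order.TTheory GRing.Theory Num.Theory.
Import numFieldNormedType.Exports.

Set Implicit Arguments.
Unset Strict Implicit.
Unset Printing Implicit Defensive.

Local Open Scope classical_set_scope.
Local Open Scope ring_scope.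

(* R^d, with the Borel sigma-algebra of its usual topology. *)
Notation borel_rV R d := (g_sigma_algebraType (@open 'rV[R]_d)).

(* The unit sphere S^(d-1) of R^d. The norm `|x| on 'rV[R]_d is the sup norm,
   so the Euclidean norm is written out. *)
Definition unit_sphere (R : realType) (d : nat) : set 'rV[R]_d :=
  [set x | \sum_(i < d) x ord0 i ^+ 2 = 1].
Arguments unit_sphere R d : clear implicits.

(* Q is in SO(d); it acts on row vectors by x |-> x *m Q. *)
Definition is_rotation (R : realType) (d : nat) (Q : 'M[R]_d) : Prop :=
  Q *m Q^T = 1%:M /\ \det Q = 1.

(* A Borel probability measure on S^(d-1) is encoded as one on R^d that gives
   mass 1 to the sphere. For d >= 2 exactly one such measure is
   rotation-invariant. *)
Definition is_surface_probability (R : realType) (d : nat)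
    (sigma : probability (borel_rV R d) R) : Prop :=
  sigma (unit_sphere R d) = 1%E /\
  forall Q : 'M[R]_d, is_rotation Q ->
  forall B : set (borel_rV R d), measurable B ->
    pushforward sigma (fun x : borel_rV R d => x *m Q : borel_rV R d) B
      = sigma B.

Definition zero_sum_free (R : realType) (d : nat) (A : set 'rV[R]_d) : Prop :=
  ~ exists x y z : 'rV[R]_d, [/\ A x, A y, A z & x + y + z = 0].

(* Measurability with respect to the completion of sigma; it includes the
   Borel sets, on which the completed measure is sigma itself. *)
Definition completed_measurable (R : realType) (d : nat)
    (sigma : probability (borel_rV R d) R) (A : set 'rV[R]_d) : Prop :=
  ((sigma^*)%mu).-cara.-measurable A.

Definition completed_measure (R : realType) (d : nat)
    (sigma : probability (borel_rV R d) R) (A : set 'rV[R]_d) : \bar R :=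
  @completed_measure_extension _ _ _ sigma A.

Lemma borel_completed_measurable (R : realType) (d : nat)
    (sigma : probability (borel_rV R d) R) (A : set (borel_rV R d)) :
  measurable A -> completed_measurable sigma A.
Proof. by move=> mA; exact: caratheodory_measurable_mu_ext. Qed.

Lemma borel_completed_measureE (R : realType) (d : nat)
    (sigma : probability (borel_rV R d) R) (A : set (borel_rV R d)) :
  measurable A -> completed_measure sigma A = sigma A.
Proof. exact: measurable_mu_extE. Qed.

Lemma measurable_unit_sphere (R : realType) (d : nat) :
  measurable (unit_sphere R d : set (borel_rV R d)).
Proof.
suff cf : continuous (fun x : 'rV[R]_d => \sum_(i < d) x ord0 i ^+ 2).
  rewrite -[X in measurable X]setCK; apply: measurableC.
  apply: sub_sigma_algebra; apply: closed_openC.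
  apply: (@preimage_closed _ _
    (fun x : 'rV[R]_d => \sum_(i < d) x ord0 i ^+ 2) [set 1]).
    by move=> x _; exact: cf.
  exact: closed_eq.
elim: (index_enum _) => [|i s IHs].
  by under eq_fun do rewrite big_nil; exact: cst_continuous.
under eq_fun do rewrite big_cons.
move=> x; apply: (@cvgD _ _ _ (nbhs x)); last exact: IHs.
have := @continuous_comp _ _ _ (fun x : 'rV[R]_d => x ord0 i)
  (fun t : R => t ^+ 2) x.
by apply; [exact: coord_continuous|exact: exprn_continuous].
Qed.

(* Main.v *)
(* For d = 4, let G be the binary icosahedral group: 120 unit quaternions, the
   vertices of the 600-cell. By invariance of sigma it suffices that, for every
   y, at most 71 of the points y g (g in G) lie in A. The group G contains a
   root system B = {w_i - w_j} of type A4. Any translate of B meets A in at most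
   12 points, because a digraph on 5 vertices without directed triangles has at
   most 12 arcs; summing over the translates y g B gives the bound 72. If 72
   were attained, every y g B would meet A in exactly 12 points, and some z = y p
   would have z and -z both in A. Then a linear identity between the translates
   z h B forces A to contain 24 of the 40 points z q with q in G of real part
   1/2 or -1/2. But these points form ten hexagons with z and -z, and each
   hexagon allows at most two of them.

   For d = 5, let x and y be independent with law sigma, normalise the
   projection of x to the equator, and move the equator to the great sphere
   orthogonal to y. The result has a rotation-invariant law, hence has law sigma
   since the invariant probability is unique, and the 4-dimensional bound
   applies on each of these great spheres. *)
Require Import Defs.
From HB Require Import structures.
From Stdlib Require Import ZArith.
From mathcomp Require Import all_boot all_order all_algebra.
From mathcomp Require Import ssrZ zify ring lra.
From mathcomp Require Import all_classical all_reals all_analysis.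
From mathcomp Require Import measurable_realfun.
Import Order.TTheory GRing.Theory Num.Theory.
Import numFieldNormedType.Exports.

Set Implicit Arguments.
Unset Strict Implicit.
Unset Printing Implicit Defensive.

Delimit Scope Z_scope with coqZ.


(** * The icosians *)

(* Elements of Z[phi], phi^2 = phi + 1, written (a, b) for a + b phi. *)
Local Notation zphi := (Z * Z)%type.
Definition zadd (u v : zphi) : zphi := (Z.add u.1 v.1, Z.add u.2 v.2).
Definition zopp (u : zphi) : zphi := (Z.opp u.1, Z.opp u.2).
Definition zsub (u v : zphi) : zphi := (Z.sub u.1 v.1, Z.sub u.2 v.2).
Definition zmul (u v : zphi) : zphi :=
  let bd := Z.mul u.2 v.2 in
  (Z.add (Z.mul u.1 v.1) bd,
   Z.add (Z.add (Z.mul u.1 v.2) (Z.mul u.2 v.1)) bd).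
Definition zhalf (u : zphi) : zphi := (Z.div2 u.1, Z.div2 u.2).

(* (a, b, c, d) stands for (a + b i + c j + d k) / 2; so the product of p and q
   is qraw p q / 4, and qmul p q is only meaningful when qraw p q is even. *)
Local Notation quat := (zphi * zphi * zphi * zphi)%type.
Definition qopp (p : quat) : quat :=
  let: (a, b, c, d) := p in (zopp a, zopp b, zopp c, zopp d).
Definition qsub (p q : quat) : quat :=
  let: (a, b, c, d) := p in let: (x, y, z, t) := q in
  (zsub a x, zsub b y, zsub c z, zsub d t).
Definition qraw (p q : quat) : quat :=
  let: (a, b, c, d) := p in let: (x, y, z, t) := q in
  (zsub (zsub (zmul a x) (zmul b y)) (zadd (zmul c z) (zmul d t)),
   zadd (zadd (zmul a y) (zmul b x)) (zsub (zmul c t) (zmul d z)),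
   zadd (zsub (zmul a z) (zmul b t)) (zadd (zmul c x) (zmul d y)),
   zadd (zadd (zmul a t) (zmul b z)) (zsub (zmul d x) (zmul c y))).
Definition qdbl (p : quat) : quat :=
  let: (a, b, c, d) := p in (zadd a a, zadd b b, zadd c c, zadd d d).
Definition qmul (p q : quat) : quat :=
  let: (a, b, c, d) := qraw p q in (zhalf a, zhalf b, zhalf c, zhalf d).
Definition qnorm (p : quat) : zphi :=
  let: (a, b, c, d) := p in
  zadd (zadd (zmul a a) (zmul b b)) (zadd (zmul c c) (zmul d d)).
Definition qre (p : quat) : zphi := p.1.1.1.

Definition zc (n : Z) : zphi := (n, Z0).
Definition q1 : quat := (zc 2, zc 0, zc 0, zc 0).

(* Five points of R^4 all of whose differences are icosians: these 20
   differences form a root system of type A4. *)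
Definition a4_weight (i : nat) : quat :=
  (nth q1
    [:: (zc 0, zc 0, zc 0, zc 0); q1;
        (zc 1, zc (-1), zc (-1), zc (-1)); (zc 1, zc (-1), zc (-1), zc 1);
        (zc 1, (0, -1), (-1, 1), zc 0)] i)%coqZ.
Definition arcs : seq (nat * nat) :=
  [seq ij <- [seq (i, j) | i <- iota 0 5, j <- iota 0 5] | ij.1 != ij.2].
Definition a4_root (ij : nat * nat) : quat :=
  qsub (a4_weight ij.1) (a4_weight ij.2).
Definition a4_def : seq quat := map a4_root arcs.
Definition a4 : seq quat := locked a4_def.

(* The 120 vertices of the 600-cell (the binary icosahedral group). *)
Definition a4_products_def : seq quat :=
  undup [seq qmul p b | p <- a4_def, b <- a4_def].
Definition a4_products : seq quat := locked a4_products_def.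
Definition icosians_def : seq quat :=
  undup [seq qmul p b | p <- a4_products_def, b <- a4_def].
Definition icosians : seq quat := locked icosians_def.

(* The lists are locked so that unification never tries to evaluate them. *)
Lemma icosiansE : (a4 = a4_def) * (a4_products = a4_products_def)
  * (icosians = icosians_def).
Proof. exact (esym (lock _), esym (lock _), esym (lock _)). Qed.

Lemma a4_productsE : a4_products = undup [seq qmul p b | p <- a4, b <- a4].
Proof. rewrite !icosiansE /a4_products_def; exact (erefl _). Qed.

Lemma icosians_productE :
  icosians = undup [seq qmul p b | p <- a4_products, b <- a4].
Proof. rewrite !icosiansE /icosians_def; exact (erefl _). Qed.

(** Coordinates are stored doubled, so these are the real parts 1/2 and -1/2. *)
Definition half_real (q : quat) : bool := qre q \in [:: zc 1; zc (-1)].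

Definition a4_type (k : nat) : seq quat :=
  [seq h <- icosians | count half_real [seq qmul h b | b <- a4] == k].
Definition a4_union (k : nat) : seq quat :=
  [seq qmul h b | h <- a4_type k, b <- a4].

Lemma size_a4 : size a4 = 20%N.
Proof. by rewrite !icosiansE; vm_compute. Qed.

Lemma size_icosians : size icosians = 120%N.
Proof. by rewrite !icosiansE; vm_compute. Qed.

(** Certifies that the halving in [qmul] loses nothing for these factors, which is what [qmxM] needs
    in order to turn [qmul] into a matrix product. *)
Lemma a4_products_exact :
  all (fun p => all (fun b => qdbl (qmul p b) == qraw p b) a4) a4.
Proof. by rewrite !icosiansE; vm_compute. Qed.

Lemma icosians_exact :
  all (fun p => all (fun b => qdbl (qmul p b) == qraw p b) a4) icosians.
Proof. by rewrite !icosiansE; vm_compute. Qed.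

Lemma a4_products_icosians :
  all (fun p => all (fun b => qdbl (qmul p b) == qraw p b) a4) a4_products.
Proof. by rewrite !icosiansE; vm_compute. Qed.

(** Closure is checked only against the 20 roots: every icosian is a product of three roots, so
    closure under all products follows. Distinctness makes each root permute the group. *)
Lemma icosians_a4_closed :
  all (fun b => let s := [seq qmul g b | g <- icosians] in
                uniq s && all [in icosians] s) a4.
Proof. by rewrite !icosiansE; vm_compute. Qed.

Lemma icosians_opp_closed :
  let s := map qopp icosians in uniq s && all [in icosians] s.
Proof. by rewrite !icosiansE; vm_compute. Qed.

Lemma icosians_norm : all (fun q => qnorm q == zc 4) icosians.
Proof. by rewrite !icosiansE; vm_compute. Qed.

(** For e = 1 or -1 the equation says that q has real part e/2. It is phrased through e - q because
    that element completes -e and q to a zero sum. *)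
Definition real_part_half (e : quat) : seq quat :=
  [seq q <- icosians | qre (qsub e q) == qre q].

(** A unit quaternion q of real part e/2 has e - q as its conjugate, that is its inverse, so the
    group is stable under this flip. *)
Lemma real_part_half_flip :
  all (fun e => let l := real_part_half e in let s := map (qsub e) l in
        [&& size s == 20%N, uniq s & all [in l] s]) [:: q1; qopp q1].
Proof. by rewrite /real_part_half !icosiansE; vm_compute. Qed.

Lemma half_realE :
  all (fun q => half_real q == (qre (qsub q1 q) == qre q)
                            || (qre (qsub (qopp q1) q) == qre q)) icosians.
Proof. by rewrite !icosiansE; vm_compute. Qed.

(* The A4 systems h a4 of types 8 and 2 are weighted so that all elements other
   than those of real part 1/2 or -1/2 cancel. *)
Lemma a4_union_count :
  let s8 := a4_union 8 in let s2 := a4_union 2 in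
  all (fun q => count_mem q s8 == (count_mem q s2 + 10 * half_real q)%N)
    icosians && all [in icosians] s8 && all [in icosians] s2.
Proof. by rewrite /a4_union /a4_type !icosiansE; vm_compute. Qed.

Lemma size_a4_type : (size (a4_type 8) = 60%N) * (size (a4_type 2) = 40%N).
Proof. by split; rewrite /a4_type !icosiansE; vm_compute. Qed.

(** If i and j are joined in both directions, the two orientations of the triangle i, j, k leave at
    most 2 arcs between k and the pair. The three other vertices thus give 6 arcs, and at most 4
    among themselves: 2 + 6 + 4 = 12. Without such a pair there are at most 10 arcs, one for each
    pair of vertices. *)
Lemma triangle_free_digraph_bound (c : nat -> nat -> nat) :
  (forall i j, (c i j <= 1)%N) ->
  (forall i j k, (c i j + c j k + c k i <= 2)%N) ->
  (\sum_(ij <- arcs) c ij.1 ij.2 <= 12)%N.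
Proof.
move=> c1 tri.
have -> : arcs = [:: (0,1);(0,2);(0,3);(0,4);(1,0);(1,2);(1,3);(1,4);
  (2,0);(2,1);(2,3);(2,4);(3,0);(3,1);(3,2);(3,4);(4,0);(4,1);(4,2);(4,3)]%N.
  by vm_compute.
rewrite !big_cons big_nil /=.
have double i j k l m : (2 <= c i j + c j i)%N ->
    (c i j + c j i + (c i k + c k i + c j k + c k j)
     + (c i l + c l i + c j l + c l j) + (c i m + c m i + c j m + c m j)
     + (c k l + c l k + c k m + c m k + c l m + c m l) <= 12)%N.
  move=> h; move: (c1 i j) (c1 j i).
  move: (tri i j k) (tri j i k) (tri i j l) (tri j i l) (tri i j m) (tri j i m).
  by move: (tri k l m) (tri k m l); lia.
case: (leqP 2 (c 0 1 + c 1 0)) => h01; first by have := double _ _ 2 3 4 h01; lia.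
case: (leqP 2 (c 0 2 + c 2 0)) => h02; first by have := double _ _ 1 3 4 h02; lia.
case: (leqP 2 (c 0 3 + c 3 0)) => h03; first by have := double _ _ 1 2 4 h03; lia.
case: (leqP 2 (c 0 4 + c 4 0)) => h04; first by have := double _ _ 1 2 3 h04; lia.
case: (leqP 2 (c 1 2 + c 2 1)) => h12; first by have := double _ _ 0 3 4 h12; lia.
case: (leqP 2 (c 1 3 + c 3 1)) => h13; first by have := double _ _ 0 2 4 h13; lia.
case: (leqP 2 (c 1 4 + c 4 1)) => h14; first by have := double _ _ 0 2 3 h14; lia.
case: (leqP 2 (c 2 3 + c 3 2)) => h23; first by have := double _ _ 0 1 4 h23; lia.
case: (leqP 2 (c 2 4 + c 4 2)) => h24; first by have := double _ _ 0 1 3 h24; lia.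
case: (leqP 2 (c 3 4 + c 4 3)) => h34; first by have := double _ _ 0 1 2 h34; lia.
lia.
Qed.

Local Open Scope ring_scope.

(** * Icosians as rotations of R^4 *)

Section QuaternionMatrix.
Variable R : realType.

Definition phi : R := (1 + Num.sqrt 5) / 2.

Lemma phi_sqr : phi * phi = phi + 1.
Proof.
have h : Num.sqrt 5 * Num.sqrt 5 = 5 :> R by rewrite -expr2 sqr_sqrtr.
by rewrite /phi; field: h.
Qed.

Definition zr (n : Z) : R := (int_of_Z n)%:~R.
Definition zev (u : zphi) : R := zr u.1 + zr u.2 * phi.

Lemma zrD m n : zr (Z.add m n) = zr m + zr n.
Proof. by rewrite /zr -[Z.add m n]/(m + n) rmorphD rmorphD. Qed.
Lemma zrN m : zr (Z.opp m) = - zr m.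
Proof. by rewrite /zr -[Z.opp m]/(- m) rmorphN rmorphN. Qed.
Lemma zrM m n : zr (Z.mul m n) = zr m * zr n.
Proof. by rewrite /zr -[Z.mul m n]/(m * n) rmorphM rmorphM. Qed.
Lemma zrB m n : zr (Z.sub m n) = zr m - zr n.
Proof. by rewrite -Z.add_opp_r zrD zrN. Qed.

Lemma zevD u v : zev (zadd u v) = zev u + zev v.
Proof. rewrite /zev /= !zrD; ring. Qed.
Lemma zevN u : zev (zopp u) = - zev u.
Proof. rewrite /zev /= !zrN; ring. Qed.
Lemma zevB u v : zev (zsub u v) = zev u - zev v.
Proof. rewrite /zev /= !zrB; ring. Qed.
Lemma zevM u v : zev (zmul u v) = zev u * zev v.
Proof. rewrite /zev /= !zrD !zrM; ring: phi_sqr. Qed.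
Lemma zev_zc n : zev (zc n) = zr n.
Proof. by rewrite /zev /zr /= mul0r addr0. Qed.

(* Right multiplication by a + b i + c j + d k, acting on row vectors. *)
Definition rmulq (a b c d : R) : 'M[R]_4 := \matrix_(i, j)
  nth 0 (nth [::] [:: [:: a; b; c; d]; [:: - b; a; - d; c];
                      [:: - c; d; a; - b]; [:: - d; - c; b; a]] i) j.

Lemma rmulqM a b c d x y z t :
  rmulq a b c d *m rmulq x y z t =
  rmulq (a * x - b * y - (c * z + d * t)) (a * y + b * x + (c * t - d * z))
        (a * z - b * t + (c * x + d * y)) (a * t + b * z + (d * x - c * y)).
Proof.
apply/matrixP => i j; rewrite !mxE !big_ord_recl big_ord0 !mxE /=.
by case: i => [[|[|[|[|//]]]] ?]; case: j => [[|[|[|[|//]]]] ?] /=; ring.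
Qed.

Lemma tr_rmulq a b c d : (rmulq a b c d)^T = rmulq a (- b) (- c) (- d).
Proof.
apply/matrixP => i j; rewrite !mxE.
by case: i => [[|[|[|[|//]]]] ?]; case: j => [[|[|[|[|//]]]] ?] /=; rewrite ?opprK.
Qed.

Lemma rmulq_scalar a : rmulq a 0 0 0 = a%:M.
Proof.
apply/matrixP => i j; rewrite !mxE.
by case: i => [[|[|[|[|//]]]] ?]; case: j => [[|[|[|[|//]]]] ?] /=;
   rewrite ?oppr0 // mulr1n.
Qed.

Lemma rmulq_orthogonal a b c d :
  rmulq a b c d *m (rmulq a b c d)^T = (a * a + b * b + (c * c + d * d))%:M.
Proof.
rewrite tr_rmulq rmulqM -rmulq_scalar; congr rmulq; ring.
Qed.

Lemma det_rmulq a b c d :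
  \det (rmulq a b c d) = (a * a + b * b + (c * c + d * d)) ^+ 2.
Proof.
rewrite (expand_det_row _ ord0) !big_ord_recl big_ord0 /cofactor.
rewrite ![\det (row' _ _)](expand_det_row _ ord0) !big_ord_recl !big_ord0 /cofactor.
rewrite ![\det (row' _ _)](expand_det_row _ ord0) !big_ord_recl !big_ord0 /cofactor.
rewrite !det_mx11 !mxE /=.
ring.
Qed.

Definition qmx (p : quat) : 'M[R]_4 :=
  let: (a, b, c, d) := p in
  rmulq (zev a / 2) (zev b / 2) (zev c / 2) (zev d / 2).

Lemma qmxN p : qmx (qopp p) = - qmx p.
Proof.
case: p => [[[a b] c] d] /=; rewrite !zevN.
apply/matrixP => i j; rewrite !mxE.
by case: i => [[|[|[|[|//]]]] ?]; case: j => [[|[|[|[|//]]]] ?] /=; ring.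
Qed.

Lemma qmxB p q : qmx (qsub p q) = qmx p - qmx q.
Proof.
case: p q => [[[a b] c] d] [[[x y] z] t] /=; rewrite !zevB.
apply/matrixP => i j; rewrite !mxE.
by case: i => [[|[|[|[|//]]]] ?]; case: j => [[|[|[|[|//]]]] ?] /=; ring.
Qed.

Lemma qmx1 : qmx q1 = 1%:M.
Proof.
rewrite /= !zev_zc -rmulq_scalar; congr rmulq; rewrite /zr /= ?mul0r //.
by rewrite divff// pnatr_eq0.
Qed.

Lemma qmxM p q : qdbl (qmul p q) == qraw p q -> qmx (qmul p q) = qmx p *m qmx q.
Proof.
case: p q => [[[a b] c] d] [[[x y] z] t].
case: (qmul _ _) => [[[r s] u] v]; rewrite /qdbl /qraw => /eqP.
case/pair_equal_spec => /pair_equal_spec[/pair_equal_spec[e1 e2] e3] e4.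
move: (congr1 zev e1) (congr1 zev e2) (congr1 zev e3) (congr1 zev e4).
rewrite !(zevD, zevB, zevM) /qmx rmulqM => {}e1 {}e2 {}e3 {}e4.
by congr rmulq; lra.
Qed.
End QuaternionMatrix.
Arguments zr R n : clear implicits.
Arguments zev R u : clear implicits.
Arguments qmx R p : clear implicits.

Lemma icosians_uniq : uniq icosians.
Proof. by rewrite icosians_productE undup_uniq. Qed.

Lemma icosians_qmul g b :
  g \in icosians -> b \in a4 -> qmul g b \in icosians.
Proof.
move=> gI ba; have /andP[_ /allP sI] := allP icosians_a4_closed b ba.
exact: sI (map_f (fun g => qmul g b) gI).
Qed.

Lemma qmx_qmul (R : realType) g b :
  g \in icosians -> b \in a4 -> qmx R (qmul g b) = qmx R g *m qmx R b.
Proof.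
move=> gI ba; apply: qmxM; exact: (allP (allP icosians_exact g gI) b ba).
Qed.

Lemma icosiansP (R : realType) h : h \in icosians ->
  exists a b c, [/\ a \in a4, b \in a4, c \in a4
                & qmx R h = qmx R a *m qmx R b *m qmx R c].
Proof.
rewrite icosians_productE mem_undup => /allpairsP[[p c] /= [pP ca ->]].
rewrite (qmxM R (allP (allP a4_products_icosians p pP) c ca)).
move: pP; rewrite a4_productsE mem_undup => /allpairsP[[a b] /= [aa ba ->]].
rewrite (qmxM R (allP (allP a4_products_exact a aa) b ba)).
by exists a, b, c.
Qed.

(** Writing h as a product of three roots reduces this to right multiplication by roots. Stated for
    matrices, where associativity is available. *)
Lemma icosiansM (R : realType) p h : p \in icosians -> h \in icosians ->
  exists2 g, g \in icosians & qmx R p *m qmx R h = qmx R g.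
Proof.
move=> pI /(icosiansP R)[a [b [c [aa ba ca ->]]]].
have g1 := icosians_qmul pI aa; have g2 := icosians_qmul g1 ba.
exists (qmul (qmul (qmul p a) b) c); first exact: icosians_qmul g2 ca.
by rewrite (qmx_qmul R g2 ca) (qmx_qmul R g1 ba) (qmx_qmul R pI aa) !mulmxA.
Qed.

Lemma perm_icosians_qmul b :
  b \in a4 -> perm_eq [seq qmul g b | g <- icosians] icosians.
Proof.
move=> ba; have /andP[us /allP sI] := allP icosians_a4_closed b ba.
have [_ e] := uniq_min_size us sI (eq_leq (esym (size_map _ _))).
exact: uniq_perm us icosians_uniq e.
Qed.

Lemma perm_icosians_qopp : perm_eq [seq qopp g | g <- icosians] icosians.
Proof.
have /andP[us /allP sI] := icosians_opp_closed.
have [_ e] := uniq_min_size us sI (eq_leq (esym (size_map _ _))).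
exact: uniq_perm us icosians_uniq e.
Qed.

Lemma perm_real_part_half e : e \in [:: q1; qopp q1] ->
  perm_eq [seq qsub e q | q <- real_part_half e] (real_part_half e).
Proof.
move=> he; have /and3P[_ us /allP sI] := allP real_part_half_flip e he.
have [_ ee] := uniq_min_size us sI (eq_leq (esym (size_map _ _))).
exact: uniq_perm us (filter_uniq _ icosians_uniq) ee.
Qed.

Lemma size_real_part_half e :
  e \in [:: q1; qopp q1] -> size (real_part_half e) = 20%N.
Proof.
move=> he; have /and3P[/eqP + _ _] := allP real_part_half_flip e he.
by rewrite size_map.
Qed.

(** Norm 4 in doubled coordinates is norm 1, and the determinant is the square of the norm. *)
Lemma qmx_rotation (R : realType) q : q \in icosians -> is_rotation (qmx R q).
Proof.
move=> /(allP icosians_norm) /eqP /(congr1 (zev R)).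
case: q => [[[a b] c] d]; rewrite /qnorm !(zevD, zevM, zev_zc) => e.
have e4 : zr R 4 = 4 by [].
rewrite e4 in e.
have {}e : zev R a / 2 * (zev R a / 2) + zev R b / 2 * (zev R b / 2) +
  (zev R c / 2 * (zev R c / 2) + zev R d / 2 * (zev R d / 2)) = 1 by lra.
by split; rewrite /qmx ?rmulq_orthogonal ?det_rmulq e // expr1n.
Qed.

Lemma sum_bound_eq (T : eqType) (s : seq T) (F : T -> nat) k :
  (forall x, x \in s -> (F x <= k)%N) ->
  (size s * k <= \sum_(x <- s) F x)%N -> forall x, x \in s -> F x = k.
Proof.
elim: s => [//|a s ih] Fk; rewrite big_cons /= mulSn => le.
have sk : (\sum_(x <- s) F x <= size s * k)%N.
  rewrite -sum1_size big_distrl /= big_seq [leqRHS]big_seq; apply: leq_sum => x xs.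
  by rewrite mul1n Fk// inE xs orbT.
have ak : (F a <= k)%N by rewrite Fk// mem_head.
have ea : F a = k by lia.
move=> x; rewrite inE => /predU1P[->//|]; apply: ih; last by lia.
by move=> y ys; rewrite Fk// inE ys orbT.
Qed.

Lemma sum_bound_ex (T : eqType) (s : seq T) (F : T -> nat) k :
  (size s * k < \sum_(x <- s) F x)%N -> exists2 x, x \in s & (k < F x)%N.
Proof.
elim: s => [|a s ih]; first by rewrite big_nil mul0n.
rewrite big_cons /= mulSn => lt.
have [ak|ka] := leqP (F a) k; last by exists a => //; exact: mem_head.
have [|x xs kx] := ih; first by lia.
by exists x => //; rewrite inE xs orbT.
Qed.

Lemma sum_count (T : eqType) (s r : seq T) (F : T -> nat) :
  uniq r -> {subset s <= r} ->
  (\sum_(x <- s) F x = \sum_(q <- r) count_mem q s * F q)%N.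
Proof.
move=> ur; elim: s => [|a s ih] sr.
  by rewrite big_nil big1_seq.
rewrite big_cons ih; last by move=> x xs; apply: sr; rewrite inE xs orbT.
have ar : a \in r by apply: sr; exact: mem_head.
rewrite [in RHS](bigD1_seq a)//= [X in (_ + X)%N](bigD1_seq a)//= eqxx.
rewrite mulnDl mul1n -!addnA; congr (_ + (_ + _))%N.
by apply: eq_bigr => q qa; rewrite eq_sym (negbTE qa).
Qed.

(** * Zero-sum-free sets on an orbit of the icosians *)

Section ZeroSumFree.
Variables (R : realType) (A : set 'rV[R]_4).
Hypothesis zsf : zero_sum_free A.
Implicit Type v : 'rV[R]_4.

Let f v : nat := `[< A v >].

Let f1 v : (f v <= 1)%N. Proof. exact: leq_b1. Qed.

Let f3 u v w : u + v + w = 0 -> (f u + f v + f w <= 2)%N.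
Proof.
move=> s0; rewrite /f.
case: asboolP => Au; last by move: (f1 v) (f1 w); rewrite /f; lia.
case: asboolP => Av; last by move: (f1 w); rewrite /f; lia.
by case: asboolP => // Aw; case: zsf; exists u, v, w.
Qed.

Let F v : nat := (\sum_(b <- a4) f (v *m qmx R b))%N.

(** Draw an arc from i to j when v (w_i - w_j) lies in A. The differences along a directed triangle
    add up to 0, so no such triangle occurs. *)
Let F_le v : (F v <= 12)%N.
Proof.
rewrite /F icosiansE big_map.
apply: (@triangle_free_digraph_bound (fun i j => f (v *m qmx R (a4_root (i, j))))) => //.
move=> i j k; apply: f3; rewrite -!mulmxDr -(mulmx0 _ v); congr (_ *m _).
by rewrite /a4_root !qmxB /= !subrKA subrr.
Qed.

Lemma icosian_orbit_bound v :
  (\sum_(g <- icosians) `[< A (v *m qmx R g) >] <= 71)%N.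
Proof.
rewrite leqNgt; apply/negP => N72.
have uI := icosians_uniq.
pose N := (\sum_(g <- icosians) f (v *m qmx R g))%N.
(* Each root permutes the orbit by right multiplication, so every point is counted 20 times. *)
have sumF : (\sum_(g <- icosians) F (v *m qmx R g) = 20 * N)%N.
  rewrite exchange_big /= -size_a4 -sum1_size big_distrl /=.
  rewrite big_seq [RHS]big_seq; apply: eq_bigr => b ba.
  rewrite mul1n /N -[RHS](perm_big _ (perm_icosians_qmul ba)) big_map.
  rewrite big_seq [RHS]big_seq; apply: eq_bigr => g gI.
  by rewrite -mulmxA qmx_qmul.
(* The average of F over the 120 translates is at least 20 * 72 / 120 = 12, which is also its
   maximum. *)
have F12 g : g \in icosians -> F (v *m qmx R g) = 12%N.
  apply: (sum_bound_eq (F := fun g => F (v *m qmx R g))) => [h _|].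
    exact: F_le.
  rewrite sumF size_icosians.
  by move: N72; rewrite -/N; lia.
(* Pigeonhole: A and -A each contain at least 72 of the 120 orbit points. *)
have [p pI hp] : exists2 p, p \in icosians &
    (1 < f (v *m qmx R p) + f (- (v *m qmx R p)))%N.
  apply: sum_bound_ex; rewrite big_split /= size_icosians.
  have -> : (\sum_(g <- icosians) f (- (v *m qmx R g)) = N)%N.
    rewrite /N -[RHS](perm_big _ perm_icosians_qopp) big_map.
    by apply: eq_bigr => g _; rewrite qmxN mulmxN.
  by move: N72; rewrite -/N; lia.
set z := v *m qmx R p in hp.
have fz : f z = 1%N by move: (f1 z) (f1 (- z)); lia.
have fNz : f (- z) = 1%N by move: (f1 z) (f1 (- z)); lia.
have Fz h : h \in icosians -> F (z *m qmx R h) = 12%N.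
  move=> hI; have [g gI e] := icosiansM R pI hI.
  by rewrite /z -mulmxA e F12.
have sum_type k : (\sum_(q <- a4_union k) f (z *m qmx R q)
                   = 12 * size (a4_type k))%N.
  rewrite big_allpairs_dep /= -sum1_size big_distrr /=.
  rewrite big_seq [RHS]big_seq; apply: eq_bigr => h.
  rewrite mem_filter => /andP[_ hI]; rewrite muln1 -[RHS](Fz _ hI).
  rewrite /F big_seq [RHS]big_seq; apply: eq_bigr => b ba.
  by rewrite -mulmxA qmx_qmul.
(* There are 60 systems of type 8 and 40 of type 2, each with 12 points in A. Their multiplicities
   differ by 10 exactly on the elements of real part 1/2 or -1/2, so 12 * 60 = 12 * 40 + 10 S. *)
have S24 : (\sum_(q <- icosians | half_real q) f (z *m qmx R q) = 24)%N.
  have /andP[/andP[/allP cnt /allP sI8] /allP sI2] := a4_union_count.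
  have := sum_type 8; have := sum_type 2; rewrite !size_a4_type.
  rewrite (sum_count _ uI sI8) (sum_count _ uI sI2).
  set S := (\sum_(q <- _ | half_real q) _)%N; move=> e2 e8.
  suff : (12 * 60 = 12 * 40 + 10 * S)%N by lia.
  rewrite -e8 -e2 {}/S [X in (10 * X)%N]big_mkcond big_distrr -big_split /=.
  rewrite big_seq [RHS]big_seq; apply: eq_bigr => q qI.
  rewrite (eqP (cnt _ qI)) mulnDl.
  by case: half_real; rewrite ?muln1 ?muln0 ?mul0n ?addn0.
(* Since z (-e) lies in A and z (-e) + z q + z (e - q) = 0, at most one of z q and z (e - q) lies in
   A. Adding over the 20 values of q counts the sum twice. *)
have S10 e : e \in [:: q1; qopp q1] -> f (z *m qmx R (qopp e)) = 1%N ->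
    (\sum_(q <- real_part_half e) f (z *m qmx R q) <= 10)%N.
  move=> he fe.
  have e2 : (\sum_(q <- real_part_half e) f (z *m qmx R (qsub e q))
             = \sum_(q <- real_part_half e) f (z *m qmx R q))%N.
    by rewrite -[RHS](perm_big _ (perm_real_part_half he)) big_map.
  suff : (\sum_(q <- real_part_half e)
      (f (z *m qmx R q) + f (z *m qmx R (qsub e q))) <= 20)%N.
    by rewrite big_split /= e2; lia.
  rewrite -(size_real_part_half he) -sum1_size; apply: leq_sum => q _.
  have /f3 : z *m qmx R (qopp e) + z *m qmx R q + z *m qmx R (qsub e q) = 0.
    rewrite -!mulmxDr -(mulmx0 _ z); congr (_ *m _).
    by rewrite qmxN qmxB (addrC (- _)) subrKA subrr.
  by rewrite fe; lia.
(* Both z and -z lie in A, so both signs of e apply and 10 + 10 contradicts 24. *)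
have : (\sum_(q <- icosians | half_real q) f (z *m qmx R q) <= 20)%N.
  have ha := S10 q1 isT; have hb := S10 (qopp q1) isT.
  have {}ha : (\sum_(q <- real_part_half q1) f (z *m qmx R q) <= 10)%N.
    by apply: ha; rewrite qmxN qmx1 mulmxN mulmx1.
  have {}hb : (\sum_(q <- real_part_half (qopp q1)) f (z *m qmx R q) <= 10)%N.
    by apply: hb; rewrite -[qopp _]/q1 qmx1 mulmx1.
  apply: leq_trans (leq_add ha hb).
  rewrite !big_filter [leqLHS]big_mkcond [X in (_ <= X + _)%N]big_mkcond.
  rewrite [X in (_ <= _ + X)%N]big_mkcond -big_split /=.
  rewrite big_seq_cond [leqRHS]big_seq_cond.
  apply: leq_sum => q; rewrite andbT => qI.
  rewrite (eqP (allP half_realE q qI)).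
  by case: (_ == _); case: (_ == _) => //=; rewrite ?leq_addr ?leq_addl.
by rewrite S24.
Qed.
End ZeroSumFree.

Local Open Scope classical_set_scope.

(** * Measurability in R^d and averages over rotations *)

Section Borel.
Variables (R : realType) (d : nat).
Local Notation V := (borel_rV R d).

Definition rat_box (q : 'rV[rat]_d * 'rV[rat]_d) : set 'rV[R]_d :=
  [set x | forall i, x ord0 i \in `]ratr (q.1 ord0 i), ratr (q.2 ord0 i)[%R].

Lemma rat_box_basis (U : set 'rV[R]_d) x : open U -> U x ->
  exists q, rat_box q x /\ rat_box q `<=` U.
Proof.
move=> oU /(open_subball oU)[/= e e0].
have e20 : 0 < e / 2 by rewrite divr_gt0.
move=> /(_ (e / 2)) sub.
have {}sub : ball x (e / 2) `<=` U.
  apply: sub => //=; rewrite sub0r normrN gtr0_norm//.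
  by rewrite ltr_pdivrMr// ltr_pMr// ltr1n.
have lt1 i : x ord0 i - e / 2 < x ord0 i by rewrite ltrBlDr ltrDl.
have lt2 i : x ord0 i < x ord0 i + e / 2 by rewrite ltrDl.
have [a aP] := choice (fun i => rat_in_itvoo (lt1 i)).
have [b bP] := choice (fun i => rat_in_itvoo (lt2 i)).
exists (\row_i a i, \row_i b i); split=> [i|y yq].
  by move: (aP i) (bP i); rewrite !mxE !in_itv/= => /andP[_ ->] /andP[->].
apply: sub; split=> // i j; rewrite (ord1 i) /ball/=.
move: (yq j) (aP j) (bP j); rewrite /= !mxE !in_itv/=.
by move=> /andP[h1 h2] /andP[h3 h4] /andP[h5 h6]; rewrite ltr_norml; lra.
Qed.

Lemma measurable_coord i : measurable_fun setT (fun x : V => x ord0 i : R).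
Proof.
apply: (measurability _ (RGenOpens.measurableE R)) => _ [_ [a [b ->] <-]].
rewrite setTI; apply: sub_sigma_algebra.
have /continuousP := @coord_continuous R 1 d ord0 i; apply; exact: interval_open.
Qed.

Lemma measurable_open (U : set 'rV[R]_d) : open U -> measurable (U : set V).
Proof. exact: sub_sigma_algebra. Qed.

(** An open set is the union of the countably many rational boxes inside it, and the preimage of a
    box is a finite intersection of coordinate preimages. *)
Lemma measurable_rV d' (T : measurableType d') (f : T -> V) :
  (forall i, measurable_fun setT (fun t => f t ord0 i : R)) ->
  measurable_fun setT f.
Proof.
move=> mf.
apply: (@measurability _ _ T V setT f (@open 'rV[R]_d)) => // _ [U oU <-].
rewrite setTI.
(* Empty for boxes not contained in U, so the union may run over all rational boxes. *)
pose F q := [set t | rat_box q `<=` U /\ rat_box q (f t)].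
rewrite (_ : _ @^-1` _ = \bigcup_q F q); last first.
  apply/seteqP; split => [t /= Ut|t [q _ [qU /qU]//]].
  by have [q [tq qU]] := rat_box_basis oU Ut; exists q.
apply: countable_bigcupT_measurable => [|q]; first exact: countableP.
have [qU|nqU] := pselect (rat_box q `<=` U); last first.
  by rewrite (_ : F q = set0)//; apply/seteqP; split => // t [].
rewrite (_ : F q = \bigcap_(i in setT)
    (fun t => f t ord0 i) @^-1` `]ratr (q.1 ord0 i), ratr (q.2 ord0 i)[);
    last first.
  by apply/seteqP; split => [t [_ h] i _|t h]; [exact: h|split => // i; exact: h].
apply: fin_bigcap_measurable => // i _.
by rewrite -[X in measurable X]setTI; exact: mf.
Qed.

Lemma measurable_mulmxr Q : measurable_fun setT (fun x : V => x *m Q : V).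
Proof.
apply: measurable_rV => i; under eq_fun do rewrite mxE.
apply: measurable_sum => j; apply: measurable_funM => //.
exact: measurable_coord.
Qed.

End Borel.

(** Integrate the pointwise bound on the number of events that occur. *)
Lemma sum_probability_le d (T : measurableType d) (R : realType)
    (P : probability T R) (I : Type) (s : seq I) (E : I -> set T) (k : nat) :
  (forall i, measurable (E i)) ->
  (forall x, (\sum_(i <- s) `[< E i x >] <= k)%N) ->
  (\sum_(i <- s) P (E i) <= k%:R%:E)%E.
Proof.
move=> mE le_k.
under eq_bigr => i _ do rewrite -[E i]setIT -(integral_indic P measurableT (mE i)).
have mi i : measurable_fun setT (fun x => (\1_(E i) x : R)%:E).
  exact/measurable_EFinP/measurable_indic.
rewrite -ge0_integral_sum//.
have ek : (\int[P]_(x in setT) (k%:R : R)%:E)%E = k%:R%:E.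
  by rewrite (integral_cst P measurableT) [X in (_ * X)%E]probability_setT mule1.
rewrite -ek.
apply: ge0_le_integral => //.
- by move=> x _; apply: sume_ge0 => i _; rewrite lee_fin.
- exact: emeasurable_sum.
- move=> x _; rewrite sumEFin lee_fin.
  apply: le_trans (_ : (\sum_(i <- s) `[< E i x >])%N%:R <= _); last by rewrite ler_nat.
  rewrite natr_sum; apply: ler_sum => i _; rewrite indicE.
  exact: lexx.
Qed.

Lemma sume_cst (R : realType) (I : Type) (s : seq I) (c : \bar R) :
  (0 <= c)%E -> (\sum_(i <- s) c = (size s)%:R%:E * c)%E.
Proof.
move=> c0; elim: s => [|i s ih]; first by rewrite big_nil mul0e.
by rewrite big_cons ih /= -nat1r EFinD ge0_muleDl ?mul1e ?lee_fin.
Qed.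

Section Rotations.
Variables (R : realType) (d : nat) (sigma : probability (borel_rV R d) R).
Local Notation V := (borel_rV R d).
Hypothesis hsigma : is_surface_probability sigma.

Lemma measurable_preimage_mulmxr (Q : 'M[R]_d) (B : set V) :
  measurable B -> measurable ([set x | B (x *m Q)] : set V).
Proof.
by move=> mB; rewrite -[X in measurable X]setTI; exact: measurable_mulmxr.
Qed.

Lemma surface_rotation (Q : 'M[R]_d) (B : set V) :
  is_rotation Q -> measurable B -> sigma [set x | B (x *m Q)] = sigma B.
Proof. by move=> rQ mB; have [_ /(_ Q rQ B mB)] := hsigma. Qed.

Lemma rotation_average (I : eqType) (s : seq I) (Q : I -> 'M[R]_d)
    (B : set V) (k : nat) :
  (forall i, i \in s -> is_rotation (Q i)) -> measurable B ->
  (forall x, (\sum_(i <- s) `[< B (x *m Q i) >] <= k)%N) ->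
  ((size s)%:R%:E * sigma B <= k%:R%:E)%E.
Proof.
move=> rQ mB le_k.
have := @sum_probability_le _ V R sigma I s (fun i => [set x | B (x *m Q i)]) k
  (fun i => measurable_preimage_mulmxr (Q i) mB) le_k.
apply: le_trans; rewrite big_seq.
under eq_bigr => i si do rewrite (surface_rotation (rQ i si) mB).
by rewrite -big_seq sume_cst// measure_ge0.
Qed.

(** Cover the complement of A by countably many Borel sets of nearly the same total mass; the
    complement of the cover is B. Carathéodory's criterion on the whole space makes the masses of A
    and its complement add up to 1. *)
Lemma completed_inner (A : set 'rV[R]_d) (e : R) :
  completed_measurable sigma A -> 0 < e ->
  exists B : set V, [/\ measurable B, B `<=` A
    & (completed_measure sigma A <= sigma B + e%:E)%E].
Proof.
move=> mA e0; pose m := completed_measure sigma.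
have mT : m setT = 1%E.
  by rewrite /m borel_completed_measureE// [LHS]probability_setT.
have split1 : (m A + m (~` A) = 1)%E.
  by rewrite -mT; have := mA setT; rewrite !setTI => /esym.
have m0 X : (0 <= m X)%E by exact: mu_ext_ge0.
have fA : m A \is a fin_num.
  rewrite ge0_fin_numE//; apply: le_lt_trans (ltry 1).
  by rewrite -split1 leeDl.
have fC : m (~` A) \is a fin_num.
  rewrite ge0_fin_numE//; apply: le_lt_trans (ltry 1).
  by rewrite -split1 leeDr.
have : (m (~` A) < m (~` A) + e%:E)%E by rewrite lteDl// lte_fin.
move=> /ereal_inf_lt[_ [F [mF AF] <-] Fe].
have mU : measurable (\bigcup_k F k) by apply: bigcup_measurable => k _; exact: mF.
exists (~` \bigcup_k F k); split; first exact: measurableC.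
  by move=> x nUx; apply: contrapT => /AF.
have sU : (sigma (\bigcup_k F k) < m (~` A) + e%:E)%E.
  apply: le_lt_trans Fe; apply: measure_sigma_subadditive => //.
rewrite probability_setC// -/m.
have fU := fin_num_measure sigma _ mU.
move: split1 sU; rewrite -(fineK fA) -(fineK fC) -(fineK fU).
rewrite -!EFinN -!EFinD lte_fin lee_fin => -[].
by lra.
Qed.
End Rotations.

(** * The squared Euclidean norm *)

Section SquaredNorm.
Variable R : realType.

Definition sqn d (x : 'rV[R]_d) : R := \sum_(i < d) x ord0 i ^+ 2.

Lemma sqnE d (x : 'rV[R]_d) : x *m x^T = (sqn x)%:M.
Proof.
rewrite [LHS]mx11_scalar !mxE; congr (_%:M).
by apply: eq_bigr => i _; rewrite !mxE expr2.
Qed.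

Lemma sqn_ge0 d (x : 'rV[R]_d) : 0 <= sqn x.
Proof. by apply: sumr_ge0 => i _; exact: sqr_ge0. Qed.

Lemma sqn_eq0 d (x : 'rV[R]_d) : sqn x = 0 -> x = 0.
Proof.
move=> /eqP; rewrite psumr_eq0 => [/allP h|i _]; last exact: sqr_ge0.
apply/rowP => i; rewrite mxE; apply/eqP; rewrite -sqrf_eq0.
exact: implyP (h i (mem_index_enum i)) isT.
Qed.

Lemma sqnZ d a (x : 'rV[R]_d) : sqn (a *: x) = a ^+ 2 * sqn x.
Proof. by rewrite /sqn mulr_sumr; apply: eq_bigr => i _; rewrite mxE exprMn. Qed.

Lemma sqn_mulmx d (x : 'rV[R]_d) (Q : 'M[R]_d) :
  Q *m Q^T = 1%:M -> sqn (x *m Q) = sqn x.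
Proof.
move=> QQ; have := sqnE (x *m Q).
rewrite trmx_mul mulmxA -(mulmxA x) QQ mulmx1 sqnE.
by move=> /matrixP/(_ ord0 ord0); rewrite !mxE eqxx !mulr1n.
Qed.

Lemma sqn_row_mx m n (x : 'rV[R]_m) (y : 'rV[R]_n) :
  sqn (row_mx x y) = sqn x + sqn y.
Proof.
rewrite /sqn big_split_ord /=; congr (_ + _).
  by apply: eq_bigr => i _; rewrite row_mxEl.
by apply: eq_bigr => i _; rewrite row_mxEr.
Qed.

Lemma sqn_normalized d (x : 'rV[R]_d) :
  x != 0 -> sqn ((sqn x) `^ (- 2^-1) *: x) = 1.
Proof.
move=> x0; rewrite sqnZ.
have s0 : sqn x != 0 by apply: contra_neq x0; exact: sqn_eq0.
rewrite -powR_mulrn ?powR_ge0// -powRrM.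
rewrite (_ : - 2^-1 * 2 = -1); last by field.
by rewrite powR_inv1 ?sqn_ge0// mulVf.
Qed.

End SquaredNorm.

(** * Reflections and equators *)

Section Householder.
Variables (R : realType) (n : nat).
Local Notation V := 'rV[R]_(n.+1 + 1).

(** The dimension is written [n.+1 + 1] so that block operations separate the polar coordinate from
    the equatorial ones, of which there is at least one. *)
Definition pole : V := row_mx 0 1%:M.

Lemma sqn_pole : sqn pole = 1.
Proof.
rewrite sqn_row_mx /sqn big1 ?add0r ?big_ord1 ?mxE ?eqxx ?expr1n// => i _.
by rewrite mxE expr0n.
Qed.

(* For unit y, the orthogonal reflection exchanging the pole and y; powR is used
   because it is known to be measurable, and 0 `^ (-1) = 0. *)
Definition householder (y : V) : 'M[R]_(n.+1 + 1) :=
  let v := y - pole in 1%:M - (2 * (sqn v) `^ (-1)) *: (v^T *m v).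

Lemma householder_tr y : (householder y)^T = householder y.
Proof. by rewrite /householder linearB linearZ /= trmx1 trmx_mul trmxK. Qed.

Lemma householderK y : householder y *m householder y = 1%:M.
Proof.
rewrite /householder; set v := y - pole; rewrite powR_inv1 ?sqn_ge0//.
set c := 2 * _.
(* When v = 0 both sides vanish, as the inverse of 0 is 0; the reflection is then the identity. *)
have e : c * c * sqn v = 2 * c.
  rewrite /c; have [->|s0] := eqVneq (sqn v) 0; first by rewrite invr0; ring.
  by field.
rewrite mulmxBl mul1mx (mulmxBr (_ *: _)) mulmx1 -scalemxAl -scalemxAr mulmxA.
rewrite -(mulmxA v^T) sqnE mul_mx_scalar.
rewrite -scalemxAl !scalerA mulrA e.
by rewrite mulr_natl mulr2n scalerDl opprB addrK subrK.
Qed.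

(** With t the inner product of the pole and y, the vector v = y - pole has squared norm 2 - 2t and
    inner product t - 1 with the pole, so the reflection adds exactly v to the pole. *)
Lemma pole_householder y : sqn y = 1 -> pole *m householder y = y.
Proof.
move=> y1; rewrite /householder powR_inv1 ?sqn_ge0//; set v := y - pole.
have [s0|s0] := eqVneq (sqn v) 0.
  rewrite s0 invr0 mulr0 scale0r subr0 mulmx1.
  by apply/esym/eqP; rewrite -subr_eq0; apply/eqP/sqn_eq0.
pose t := (pole *m y^T) ord0 ord0.
have et : pole *m v^T = (t - 1)%:M.
  rewrite linearB /= mulmxBr sqnE sqn_pole [pole *m y^T]mx11_scalar.
  by rewrite -/t -raddfB.
have es : sqn v = 2 - 2 * t.
  have : y *m pole^T = t%:M.
    by rewrite -[LHS]trmxK trmx_mul trmxK [pole *m _]mx11_scalar tr_scalar_mx.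
  move=> et'; have := sqnE v.
  rewrite {1 2}/v linearB /= mulmxBl !mulmxBr !sqnE sqn_pole y1 et'.
  rewrite [pole *m y^T]mx11_scalar -/t => /matrixP/(_ ord0 ord0).
  by rewrite !mxE eqxx !mulr1n => <-; ring.
rewrite mulmxBr mulmx1 -scalemxAr mulmxA et mul_scalar_mx scalerA.
rewrite [X in X *: _](_ : _ = -1).
  by rewrite scaleN1r opprK /v addrC subrK.
by rewrite es; field; rewrite -es.
Qed.

Lemma householder_orthogonal y : householder y *m (householder y)^T = 1%:M.
Proof. by rewrite householder_tr householderK. Qed.

Lemma orthogonal_det m (Q : 'M[R]_m) : Q *m Q^T = 1%:M -> \det Q * \det Q = 1.
Proof. by move=> QQ; rewrite -{2}(det_tr Q) -det_mulmx QQ det1. Qed.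

(** The reflection may have determinant -1; multiplying one equatorial coordinate by its determinant
    beforehand corrects this and fixes the pole. *)
Lemma rotation_from_pole y : sqn y = 1 ->
  exists2 Q : 'M[R]_(n.+1 + 1), is_rotation Q & pole *m Q = y.
Proof.
move=> y1; set H := householder y; pose dt := \det H.
have dd : dt * dt = 1 by exact/orthogonal_det/householder_orthogonal.
pose r : V := \row_j if j == ord0 then dt else 1.
have rr : diag_mx r *m diag_mx r = 1%:M.
  apply/matrixP => i j; rewrite mul_mx_diag !mxE.
  case: (eqVneq i j) => [->|_]; last by rewrite !mulr0n mul0r.
  by rewrite !mulr1n; case: ifP => _ //; rewrite mulr1.
exists (diag_mx r *m H); last first.
  rewrite mulmxA -[RHS](pole_householder y1); congr (_ *m _).
  rewrite mul_mx_diag; apply/rowP => j; rewrite !mxE.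
  case: (eqVneq j ord0) => [->|_]; last by rewrite mulr1.
  by case: splitP => // k _; rewrite mxE mul0r.
split.
  rewrite trmx_mul tr_diag_mx mulmxA -(mulmxA _ H) householder_orthogonal.
  by rewrite mulmx1 rr.
rewrite det_mulmx det_diag (bigD1 ord0)//= mxE eqxx big1 ?mulr1//.
by move=> j jn0; rewrite mxE (negbTE jn0).
Qed.

(* Equal to 0 on the polar axis. *)
Definition equator_dir (x : V) : 'rV[R]_n.+1 :=
  (sqn (lsubmx x)) `^ (- 2^-1) *: lsubmx x.

Lemma sqn_equator_dir x : lsubmx x != 0 -> sqn (equator_dir x) = 1.
Proof. exact: sqn_normalized. Qed.

(** The corner entry makes the determinant a square, so that improper orthogonal W also extend to
    rotations. *)
Definition equator_rotation (W : 'M[R]_n.+1) : 'M[R]_(n.+1 + 1) :=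
  block_mx W 0 0 (\det W)%:M.

Lemma equator_rotationP W :
  W *m W^T = 1%:M -> is_rotation (equator_rotation W).
Proof.
move=> WW; have dd := orthogonal_det WW; split.
  rewrite tr_block_mx mulmx_block !trmx0 !mulmx0 !mul0mx !addr0 !add0r WW.
  by rewrite tr_scalar_mx -scalar_mxM dd -scalar_mx_block.
by rewrite det_lblock det_scalar1.
Qed.

Lemma equator_dir_rotation W x : W *m W^T = 1%:M ->
  equator_dir (x *m equator_rotation W) = equator_dir x *m W.
Proof.
move=> WW; rewrite /equator_dir -{1 2}(hsubmxK x) mul_row_block mulmx0 addr0.
by rewrite row_mxKl sqn_mulmx// -scalemxAl.
Qed.

(** For unit y the reflection sends the pole to y, hence the equator to the great sphere orthogonal
    to y. *)
Definition equator_point (x y : V) : V :=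
  row_mx (equator_dir x) 0 *m householder y.

Lemma sqn_equator_point x y : lsubmx x != 0 -> sqn (equator_point x y) = 1.
Proof.
move=> x0; rewrite sqn_mulmx; last exact: householder_orthogonal.
rewrite sqn_row_mx sqn_equator_dir// {1}/sqn big_ord1 mxE expr0n addr0//.
Qed.

Lemma equator_point_rotation W x y : W *m W^T = 1%:M ->
  equator_point (x *m equator_rotation W) y
  = row_mx (equator_dir x *m W) 0 *m householder y.
Proof. by move=> WW; rewrite /equator_point equator_dir_rotation. Qed.

(** Following Q by the reflections of y and y Q gives an orthogonal T that fixes the pole, hence
    acts on the equator by some orthogonal W. This W can be applied to x instead. *)
Lemma equator_point_equivariant (Q : 'M[R]_(n.+1 + 1)) y :
  Q *m Q^T = 1%:M -> sqn y = 1 ->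
  exists2 Q' : 'M[R]_(n.+1 + 1), is_rotation Q' &
    forall x, equator_point x y *m Q = equator_point (x *m Q') (y *m Q).
Proof.
move=> QQ y1; have yQ1 : sqn (y *m Q) = 1 by rewrite sqn_mulmx.
pose T := householder y *m Q *m householder (y *m Q).
have TT : T *m T^T = 1%:M.
  rewrite /T trmx_mul mulmxA -(mulmxA _ (householder (y *m Q))).
  rewrite householder_orthogonal mulmx1 trmx_mul mulmxA -(mulmxA _ Q) QQ mulmx1.
  exact: householder_orthogonal.
have eT : pole *m T = pole.
  rewrite /T !mulmxA pole_householder// -{1}(pole_householder yQ1).
  by rewrite -mulmxA householderK mulmx1.
(* The transpose fixes the pole too, so both the last row and the last column of T are trivial. *)
have eTt : pole *m T^T = pole.
  by rewrite -{1}eT -mulmxA TT mulmx1.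
have bot : row_mx (dlsubmx T) (drsubmx T) = row_mx 0 1%:M.
  move: eT; rewrite -{1}(submxK T) /pole mul_row_block !mul0mx !add0r !mul1mx.
  exact.
have right : row_mx (ursubmx T)^T (drsubmx T)^T = row_mx 0 1%:M.
  move: eTt; rewrite -{1}(submxK T) tr_block_mx /pole mul_row_block.
  by rewrite !mul0mx !add0r !mul1mx.
have [dl dr] := eq_row_mx bot.
have [ur _] := eq_row_mx right.
have {}ur : ursubmx T = 0 by rewrite -[LHS]trmxK ur trmx0.
pose W := ulsubmx T.
have TE : T = block_mx W 0 0 1%:M by rewrite -[LHS]submxK dl dr ur.
have WW : W *m W^T = 1%:M.
  move: TT; rewrite TE tr_block_mx mulmx_block !trmx0 !mulmx0 !mul0mx !addr0.
  by rewrite !add0r (scalar_mx_block _ 1) => /eq_block_mx[].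
exists (equator_rotation W); first exact: equator_rotationP.
move=> x; rewrite equator_point_rotation// /equator_point.
have -> : row_mx (equator_dir x *m W) 0 = row_mx (equator_dir x) (0 : 'rV_1) *m T.
  by rewrite TE mul_row_block !mulmx0 !mul0mx !addr0.
by rewrite /T -!mulmxA householderK mulmx1.
Qed.

End Householder.

Lemma probability1I d (T : measurableType d) (R : realType)
    (P : probability T R) (S X : set T) :
  measurable S -> measurable X -> P S = 1%E -> P (S `&` X) = P X.
Proof.
move=> mS mX PS; apply/eqP; rewrite eq_le; apply/andP; split.
  by apply: le_measure; rewrite ?inE//; exact: measurableI.
have PC : P (~` S) = 0%E by rewrite probability_setC// PS subee.
have : (P X <= P ((S `&` X) `|` ~` S))%E.
  apply: le_measure; rewrite ?inE//.
    by apply: measurableU; [exact: measurableI|exact: measurableC].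
  by move=> x Xx; have [Sx|nSx] := pselect (S x); [left|right].
move/le_trans; apply; rewrite -[leRHS]adde0 -PC.
by apply: measureU2; [exact: measurableI|exact: measurableC].
Qed.

(** * Uniqueness of the surface probability *)

Section Caps.
Variables (R : realType) (d : nat).
Local Notation V := (borel_rV R d).

(** A ball of R^d with squared radius r. Its trace on the sphere is the spherical cap and has the
    same mass, as the measures live on the sphere. *)
Definition cap (x : 'rV[R]_d) (r : R) : set 'rV[R]_d := [set y | sqn (y - x) < r].

Lemma cap_sym x y r : cap x r y = cap y r x.
Proof.
rewrite /cap /= (_ : sqn (x - y) = sqn (y - x))//.
by apply: eq_bigr => i _; rewrite !mxE; ring.
Qed.

Lemma measurable_sqnB : measurable_fun setT
  (fun z : V * V => sqn ((z.2 : 'rV[R]_d) - z.1) : R).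
Proof.
apply: measurable_sum => i; apply: measurable_funX.
under eq_fun do rewrite !mxE.
apply: measurable_funB.
  exact: (measurableT_comp (measurable_coord i) measurable_snd).
exact: (measurableT_comp (measurable_coord i) measurable_fst).
Qed.

Lemma cap_open x r : open (cap x r).
Proof.
have ci i : continuous (fun y : 'rV[R]_d => (y - x) ord0 i ^+ 2).
  move=> y; rewrite (_ : (fun y => _) = (fun t : R => (t - x ord0 i) ^+ 2)
      \o (fun y : 'rV[R]_d => y ord0 i)); last by apply/funext => z /=; rewrite !mxE.
  have := @continuous_comp _ _ _ (fun y : 'rV[R]_d => y ord0 i)
    (fun t : R => (t - x ord0 i) ^+ 2) y.
  apply; first exact: coord_continuous.
  have := @continuous_comp _ _ _ (fun t : R => t - x ord0 i) (fun t : R => t ^+ 2)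
    (y ord0 i).
  apply; last exact: exprn_continuous.
  by apply: cvgB; [exact: cvg_id|exact: cvg_cst].
have cf : continuous (fun y : 'rV[R]_d => sqn (y - x)).
  rewrite /sqn; elim: (index_enum _) => [|i s IHs].
    by under eq_fun do rewrite big_nil; exact: cst_continuous.
  under eq_fun do rewrite big_cons.
  by move=> y; apply: (@cvgD _ _ _ (nbhs y)); [exact: ci|exact: IHs].
rewrite (_ : cap x r = (fun y => sqn (y - x)) @^-1` `]-oo, r[).
  by apply: open_comp => // y _; exact: cf.
by apply/seteqP; split => y; rewrite /= in_itv.
Qed.

Lemma measurable_cap x r : measurable (cap x r : set V).
Proof. exact: (measurable_open (@cap_open x r)). Qed.

Lemma cap_subset_open (U : set 'rV[R]_d) x : open U -> U x ->
  exists k : nat, cap x k.+1%:R^-1 `<=` U.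
Proof.
move=> oU /(open_subball oU)[/= e e0] /(_ (e / 2)) sub.
have e2 : 0 < e / 2 by rewrite divr_gt0.
have {}sub : ball x (e / 2) `<=` U.
  apply: sub => //=; rewrite sub0r normrN gtr0_norm//.
  by rewrite ltr_pdivrMr// ltr_pMr// ltr1n.
have [k ke] : exists k : nat, k.+1%:R^-1 < (e / 2) ^+ 2.
  exists (Num.truncn ((e / 2) ^- 2)).
  rewrite -ltf_pV2 ?posrE ?exprn_gt0// ?invr_gt0// invrK.
  by rewrite truncnS_gt.
exists k => y xy; apply: sub; split=> // i j; rewrite (ord1 i) /ball/=.
rewrite distrC -(ltr_pXn2r (ltn0Sn 1)) ?nnegrE//; last exact: ltW.
rewrite real_normK ?num_real//; apply: le_lt_trans ke; apply: ltW.
apply: le_lt_trans xy; rewrite /sqn (bigD1 j)//= !mxE lerDl.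
by apply: sumr_ge0 => l _; exact: sqr_ge0.
Qed.

End Caps.

Lemma integral_two_valued d (T : measurableType d) (R : realType)
    (mu : {measure set T -> \bar R}) (X : set T) (b : \bar R) (g : T -> \bar R) :
  measurable X -> (0 <= b)%E -> (forall x, X x -> g x = b) ->
  (forall x, ~ X x -> g x = 0%E) -> (\int[mu]_x g x = b * mu X)%E.
Proof.
move=> mX b0 gX gNX; rewrite -[X in mu X]setIT -(integral_indic mu measurableT mX).
rewrite -ge0_integralZl//; last exact/measurable_EFinP/measurable_indic.
apply: eq_integral => x _; rewrite indicE.
have [/set_mem Xx|/negP nXx] := boolP (x \in X); first by rewrite gX// mule1.
by rewrite gNX ?mule0// => Xx; apply: nXx; rewrite inE.
Qed.

Section Uniqueness.
Variables (R : realType) (n : nat).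
Local Notation d := (n.+1 + 1)%N.
Local Notation V := (borel_rV R d).
Local Notation S := (unit_sphere R d).
Local Notation pole := (pole R n).
Implicit Types sigma tau : probability V R.

Lemma surface_cap sigma x r : is_surface_probability sigma -> sqn x = 1 ->
  sigma (cap x r) = sigma (cap pole r).
Proof.
move=> hs x1; have [Q rQ eQ] := rotation_from_pole x1.
rewrite -(surface_rotation hs rQ (measurable_cap x r)); congr (sigma _).
apply/seteqP; split => z;
  by rewrite /cap /= -eQ -mulmxBl sqn_mulmx//; case: rQ.
Qed.

(* Fubini for the pairs (x, y) with y in the cap of x, using that all caps of a
   given radius have the same measure. *)
Lemma cap_double_count sigma tau (W U : set V) r :
  is_surface_probability sigma -> is_surface_probability tau ->
  measurable W -> measurable U ->
  (forall x y, S x -> S y -> W x -> cap x r y -> U y) ->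
  (tau (cap pole r) * sigma W <= sigma (cap pole r) * tau U)%E.
Proof.
move=> hs ht mW mU WU; have mS := @measurable_unit_sphere R d.
have mD : measurable [set z : V * V | cap z.1 r z.2].
  rewrite (_ : [set _ | _] =
      (fun z : V * V => sqn ((z.2 : 'rV[R]_d) - z.1)) @^-1` `]-oo, r[).
    by rewrite -[X in measurable X]setTI; exact: measurable_sqnB.
  by apply/seteqP; split => y; rewrite /= in_itv.
pose E := [set z : V * V | cap z.1 r z.2] `&` ((S `&` W) `*` S).
pose F := [set z : V * V | cap z.1 r z.2] `&` (S `*` (S `&` U)).
have mE : measurable E.
  by apply: measurableI => //; apply: measurableX => //; exact: measurableI.
have mF : measurable F.
  by apply: measurableI => //; apply: measurableX => //; exact: measurableI.
have EF : ((sigma \x tau) E <= (sigma \x tau) F)%E.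
  apply: le_measure; rewrite ?inE// => -[x y] [/= xy [[Sx Wx] Sy]].
  by split=> //; split=> //; split=> //; exact: WU xy.
have eE : (sigma \x tau)%E E = (tau (cap pole r) * sigma W)%E.
  rewrite -(probability1I mS mW hs.1); apply: integral_two_valued.
  - exact: measurableI.
  - exact: measure_ge0.
  - move=> x [Sx Wx] /=.
    rewrite -(surface_cap r ht Sx) -(probability1I mS (measurable_cap x r) ht.1).
    congr (tau _); apply/seteqP; split => y; rewrite /xsection /= inE.
      by move=> [xy [_ Sy]].
    by move=> [Sy xy].
  - move=> x nSW /=; rewrite -(measure0 tau); congr (tau _).
    by apply/seteqP; split => // y; rewrite /xsection /= inE => -[_ [/nSW]].
have eF : (sigma \x tau)%E F = (sigma (cap pole r) * tau U)%E.
  have := @product_measure_unique _ _ V V R sigma tau (sigma \x^ tau)%E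
    (fun A B mA mB => product_measure2E sigma tau mA mB) F mF.
  move=> ->.
  rewrite -(probability1I mS mU ht.1); apply: integral_two_valued.
  - exact: measurableI.
  - exact: measure_ge0.
  - move=> y [Sy Uy] /=.
    rewrite -(surface_cap r hs Sy) -(probability1I mS (measurable_cap y r) hs.1).
    congr (sigma _); apply/seteqP; split => x; rewrite /ysection /= inE.
      by move=> [/= xy [Sx _]]; split => //; rewrite cap_sym.
    by move=> [Sx xy]; split => //=; rewrite cap_sym.
  - move=> y nSU /=; rewrite -(measure0 sigma); congr (sigma _).
    by apply/seteqP; split => // x; rewrite /ysection /= inE => -[_ [_ /nSU]].
by rewrite -eE -eF.
Qed.

(** With both sets equal to the whole space, double counting compares the cap masses themselves. *)
Lemma surface_cap_eq sigma tau r :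
  is_surface_probability sigma -> is_surface_probability tau ->
  sigma (cap pole r) = tau (cap pole r).
Proof.
move=> hs ht; apply/eqP; rewrite eq_le; apply/andP; split.
  have := cap_double_count (W := setT) (U := setT) (r := r) ht hs
    measurableT measurableT (fun _ _ _ _ _ _ => I).
  by rewrite [X in (_ * X)%E]probability_setT
  [X in (_ <= _ * X)%E]probability_setT !mule1.
have := cap_double_count (W := setT) (U := setT) (r := r) hs ht
  measurableT measurableT (fun _ _ _ _ _ _ => I).
by rewrite [X in (_ * X)%E]probability_setT
  [X in (_ <= _ * X)%E]probability_setT !mule1.
Qed.

(** If one cap were null, all caps of that radius would be. The countably many rational boxes inside
    them cover the sphere, which would then be null. *)
Lemma surface_cap_gt0 sigma r : is_surface_probability sigma -> 0 < r ->
  (0 < sigma (cap pole r))%E.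
Proof.
move=> hs r0; rewrite lt0e measure_ge0 andbT; apply/eqP => cap0.
pose Fq q := if `[< exists x, S x /\ @rat_box R d q `<=` cap x r >]
  then @rat_box R d q else set0.
pose F (k : nat) := if unpickle k is Some q then Fq q else set0.
have Fneg k : sigma.-negligible (F k : set V).
  rewrite /F; case: (unpickle k) => [q|]; last exact: negligible_set0.
  rewrite /Fq; case: asboolP => [[x [Sx qx]]|_]; last exact: negligible_set0.
  exists (cap x r); split => //; first exact: measurable_cap.
  by rewrite surface_cap.
have [N [mN N0 FN]] := negligible_bigcup Fneg.
suff : (sigma S <= sigma N)%E by rewrite hs.1 N0 lee_fin ler10.
apply: le_measure; rewrite ?inE//; first exact: measurable_unit_sphere.
apply: subset_trans FN => x Sx.
have xx : cap x r x by rewrite /cap /= subrr /sqn big1// => i _; rewrite mxE expr0n.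
have [q [qx qU]] := rat_box_basis (@cap_open R d x r) xx.
exists (pickle q) => //; rewrite /F pickleK /Fq.
by case: asboolP => // -[]; exists x.
Qed.

(** Apply double counting to U and the set W_k of points whose cap of squared radius 1/(k+1) lies in
    U, cancel the common positive cap mass, and let W_k increase to U. *)
Lemma surface_open_le sigma tau (U : set 'rV[R]_d) :
  is_surface_probability sigma -> is_surface_probability tau -> open U ->
  (sigma U <= tau U)%E.
Proof.
move=> hs ht oU; have mU : measurable (U : set V) := measurable_open oU.
(* Written as the complement of a union of open caps, W k is closed and hence Borel. *)
pose W (k : nat) : set V := ~` \bigcup_(y in ~` U) cap y k.+1%:R^-1.
have WE k x : W k x <-> cap x k.+1%:R^-1 `<=` U.
  split=> [Wx y xy|xU [y nUy]].
    by apply: contrapT => nUy; apply: Wx; exists y => //; rewrite cap_sym.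
  by rewrite cap_sym => /xU.
have mW k : measurable (W k).
  have oB : open (\bigcup_(y in ~` U) cap y k.+1%:R^-1).
    by apply: bigcup_open => y _; exact: cap_open.
  exact: (measurableC (measurable_open oB)).
have xx (x : 'rV[R]_d) (k : nat) : cap x k.+1%:R^-1 x.
  by rewrite /cap /= subrr /sqn big1 ?invr_gt0// => i _; rewrite mxE expr0n.
have WU : \bigcup_k W k = U.
  apply/seteqP; split => [x [k _ /WE]|x Ux]; first by apply; exact: xx.
  by have [k kU] := cap_subset_open oU Ux; exists k => //; exact/WE.
have W_le k : (sigma (W k) <= tau U)%E.
  have r0 : 0 < k.+1%:R^-1 :> R by rewrite invr_gt0.
  have := cap_double_count (r := k.+1%:R^-1) hs ht (mW k) mU
    (fun x y _ _ Wx xy => (WE k x).1 Wx y xy).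
  rewrite (surface_cap_eq _ ht hs).
  rewrite lee_pmul2l//; first exact: fin_num_measure (measurable_cap _ _).
  exact: surface_cap_gt0.
have ndW : {homo W : a b / (a <= b)%N >-> (a <= b)%O}.
  move=> a b ab; apply/subsetPset => x /WE aU; apply/WE => y yb; apply: aU.
  by apply: lt_le_trans yb _; rewrite lef_pV2 ?posrE// ler_nat.
have := @nondecreasing_cvg_mu _ _ _ sigma W mW.
rewrite WU => /(_ mU ndW) cvW.
rewrite -(cvg_lim _ cvW)//; apply: lime_le; first by apply/cvg_ex; exists (sigma U).
by apply: nearW => k; exact: W_le.
Qed.

Lemma surface_unique sigma tau (B : set V) :
  is_surface_probability sigma -> is_surface_probability tau ->
  measurable B -> sigma B = tau B.
Proof.
move=> hs ht; apply: (@measure_unique _ R V (@open 'rV[R]_d) (fun=> setT)) => //.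
- by move=> X Y; exact: openI.
- by move=> _; exact: openT.
- by apply/seteqP; split => // x _; exists 0%N.
- by move=> A oA; apply/eqP; rewrite eq_le !surface_open_le.
- by move=> _; rewrite [X in (X < _)%E]probability_setT ltry.
Qed.

End Uniqueness.

(** * Random equators *)

Section Equator.
Variables (R : realType) (n : nat).
Local Notation d := (n.+1 + 1)%N.
Local Notation V := (borel_rV R d).
Local Notation S := (unit_sphere R d).
Local Notation pole := (pole R n).

Lemma measurable_lsubmx : measurable_fun setT
  (fun x : V => lsubmx (x : 'rV[R]_d) : borel_rV R n.+1).
Proof.
apply: measurable_rV => i; under eq_fun do rewrite mxE.
exact: measurable_coord.
Qed.

Lemma measurable_sqn m : measurable_fun setT (fun x : borel_rV R m => sqn (x : 'rV[R]_m)).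
Proof.
by apply: measurable_sum => i; apply: measurable_funX; exact: measurable_coord.
Qed.

Lemma measurable_equator_dir : measurable_fun setT
  (fun x : V => equator_dir (x : 'rV[R]_d) : borel_rV R n.+1).
Proof.
apply: measurable_rV => i; rewrite /equator_dir; under eq_fun do rewrite mxE.
apply: measurable_funM; last first.
  exact: (measurableT_comp (measurable_coord i) measurable_lsubmx).
exact: (measurableT_comp (measurable_powR _)
  (measurableT_comp (@measurable_sqn _) measurable_lsubmx)).
Qed.

Lemma measurable_householder i j : measurable_fun setT
  (fun y : V => householder (y : 'rV[R]_d) i j : R).
Proof.
have mv : measurable_fun setT (fun y : V => (y : 'rV[R]_d) - pole : V).
  apply: measurable_rV => k; under eq_fun do rewrite !mxE.
  by apply: measurable_funB => //; exact: measurable_coord.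
rewrite /householder; under eq_fun do rewrite mxE [X in _ + X]mxE [X in - X]mxE.
apply: measurable_funB; first exact: measurable_cst.
apply: measurable_funM.
  apply: measurable_funM; first exact: measurable_cst.
  exact: (measurableT_comp (measurable_powR _)
    (measurableT_comp (@measurable_sqn _) mv)).
under eq_fun do rewrite mxE.
apply: measurable_sum => k; rewrite (ord1 k).
under eq_fun do rewrite mxE.
by apply: measurable_funM;
  [exact: (measurableT_comp (measurable_coord i) mv)
  |exact: (measurableT_comp (measurable_coord j) mv)].
Qed.

Lemma measurable_equator_point : measurable_fun setT
  (fun z : V * V => equator_point (z.1 : 'rV[R]_d) z.2 : V).
Proof.
apply: measurable_rV => i; rewrite /equator_point; under eq_fun do rewrite mxE.
apply: measurable_sum => j; apply: measurable_funM; last first.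
  exact: (measurableT_comp (measurable_householder j i) measurable_snd).
rewrite -(splitK j); case: (fintype.split j) => k /=.
  under eq_fun do rewrite row_mxEl.
  exact: (measurableT_comp (measurable_coord k)
    (measurableT_comp measurable_equator_dir measurable_fst)).
by under eq_fun do rewrite row_mxEr mxE; exact: measurable_cst.
Qed.

Lemma measurable_polar_axis :
  measurable ([set x | lsubmx (x : 'rV[R]_d) = 0] : set V).
Proof.
rewrite (_ : [set _ | _] = (fun x : V => sqn (lsubmx (x : 'rV[R]_d))) @^-1` [set 0]).
  rewrite -[X in measurable X]setTI.
  exact: (measurableT_comp (@measurable_sqn _) measurable_lsubmx).
apply/seteqP; split => x /= => [->|/sqn_eq0//].
by rewrite /sqn big1// => i _; rewrite mxE expr0n.
Qed.

Variable sigma : probability V R.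
Hypothesis hsigma : is_surface_probability sigma.

Lemma rotation_tr (Q : 'M[R]_d) : is_rotation Q -> is_rotation Q^T.
Proof. by move=> [QQ dQ]; split; rewrite ?det_tr// trmxK; exact: mulmx1C. Qed.

(* The axis has arbitrarily many rotated copies meeting only at 0. *)
Lemma polar_axis_null : sigma [set x | lsubmx (x : 'rV[R]_d) = 0] = 0%E.
Proof.
have mS := @measurable_unit_sphere R d.
pose Z : set V := [set x | lsubmx (x : 'rV[R]_d) = 0].
have mZ : measurable Z by exact: measurable_polar_axis.
rewrite -/Z -(probability1I mS mZ hsigma.1).
set B := S `&` Z; have mB : measurable (B : set V) by exact: measurableI.
pose w (k : nat) : 'rV[R]_d := row_mx (\row_i k%:R) 1%:M.
have w0 k : w k != 0.
  apply/eqP => /(congr1 (fun z => rsubmx z ord0 ord0)).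
  by rewrite row_mxKr !mxE eqxx => /eqP; rewrite oner_eq0.
pose v k := (sqn (w k)) `^ (- 2^-1) *: w k.
have v1 k : sqn (v k) = 1 by exact: sqn_normalized.
pose Q k := (sval (cid2 (rotation_from_pole (v1 k)))).
have QP k : is_rotation (Q k) /\ pole *m Q k = v k.
  by rewrite /Q; case: cid2.
(* A unit vector on the k-th rotated axis is a nonzero multiple of [w k], so the ratio of its first
   to its last coordinate recovers k, and it lies on no other copy. *)
have key x k : B (x *m (Q k)^T) ->
    k%:R = x ord0 (lshift 1 ord0) / x ord0 (rshift n.+1 ord0).
  move=> [xS xZ]; have [[QQ _] eQ] := QP k.
  have QtQ : (Q k)^T *m Q k = 1%:M by exact: mulmx1C.
  set y := x *m (Q k)^T in xS xZ.
  have ey : y = rsubmx y ord0 ord0 *: pole.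
    rewrite -[LHS]hsubmxK xZ /pole scale_row_mx scaler0; congr row_mx.
    by rewrite [LHS]mx11_scalar scalemx1.
  have ex : x = (rsubmx y ord0 ord0 * (sqn (w k)) `^ (- 2^-1)) *: w k.
    by rewrite -scalerA -/(v k) -eQ scalemxAl -ey /y -mulmxA QtQ mulmx1.
  have x1 : sqn x = 1.
    by rewrite -[RHS]xS -/(sqn y) /y sqn_mulmx// trmxK.
  set a := _ * _ in ex.
  have a0 : a != 0.
    apply: contra_eq_neq x1 => a0; rewrite ex a0 scale0r /sqn big1.
      by rewrite eq_sym oner_neq0.
    by move=> i _; rewrite mxE expr0n.
  rewrite ex !mxE (unsplitK (inl ord0)) (unsplitK (inr ord0)) !mxE eqxx mulr1.
  by rewrite mulrAC divff// mul1r.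
(* N disjoint copies of equal mass fit into total mass 1, for every N. *)
have le1 N : ((size (iota 0 N))%:R%:E * sigma B <= 1%:R%:E)%E.
  apply: (rotation_average hsigma (Q := fun k => (Q k)^T)) => //.
    by move=> k _; apply: rotation_tr; case: (QP k).
  move=> x; set r := x ord0 (lshift 1 ord0) / x ord0 (rshift n.+1 ord0).
  apply: (@leq_trans (\sum_(k <- iota 0 N) (k%:R == r))).
    apply: leq_sum => k _; case: asboolP => // /key ->.
    by rewrite eqxx.
  have [[k0 e0]|ne] := pselect (exists k, k%:R = r); last first.
    by rewrite big1// => k _; case: eqP => // ek; case: ne; exists k.
  rewrite -e0; under eq_bigr => k _ do rewrite eqr_nat.
  rewrite (eq_bigr (fun k => if k == k0 then 1 else 0)%N) => [|k _]; last first.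
    by case: eqP.
  by rewrite -big_mkcond sum1_count (count_uniq_mem k0 (iota_uniq 0 N)) leq_b1.
have fB := fin_num_measure sigma _ mB.
apply/eqP; rewrite eq_le measure_ge0 andbT.
move: le1; rewrite -(fineK fB) => le1.
rewrite lee_fin leNgt; apply/negP => b0.
have := le1 (Num.truncn (fine (sigma B))^-1).+1.
rewrite size_iota -EFinM lee_fin leNgt => /negP; apply.
by rewrite -ltr_pdivrMr// mul1r truncnS_gt.
Qed.

End Equator.

Lemma product_measure_xsection d1 d2 (T1 : measurableType d1)
    (T2 : measurableType d2) (R : realType)
    (P : probability T1 R) (Q : probability T2 R) (E F : set (T1 * T2)) :
  (forall x, Q (xsection E x) = Q (xsection F x)) ->
  (P \x Q)%E E = (P \x Q)%E F.
Proof. by move=> EF; apply: eq_integral => x _; exact: EF. Qed.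

Lemma product_measure_ysection d1 d2 (T1 : measurableType d1)
    (T2 : measurableType d2) (R : realType)
    (P : probability T1 R) (Q : probability T2 R) (E F : set (T1 * T2)) :
  measurable E -> measurable F ->
  (forall y, P (ysection E y) = P (ysection F y)) ->
  (P \x Q)%E E = (P \x Q)%E F.
Proof.
move=> mE mF EF.
have PQ X : measurable X -> (P \x Q)%E X = (P \x^ Q)%E X.
  exact: (product_measure_unique (fun A B mA mB => product_measure2E P Q mA mB)).
by rewrite !PQ//; apply: eq_integral => y _; exact: EF.
Qed.

Section RandomEquator.
Variables (R : realType) (n : nat).
Local Notation d := (n.+1 + 1)%N.
Local Notation V := (borel_rV R d).
Local Notation S := (unit_sphere R d).
Variable sigma : probability V R.
Hypothesis hsigma : is_surface_probability sigma.

Let p (z : V * V) : V := equator_point (z.1 : 'rV[R]_d) z.2.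

HB.instance Definition _ :=
  isMeasurableFun.Build _ _ _ _ p (@measurable_equator_point R n).

Definition random_equator : probability V R := distribution (sigma \x sigma)%E p.

Let mp (B : set V) : measurable B -> measurable [set z : V * V | B (p z)].
Proof.
move=> mB; rewrite -[X in measurable X]setTI.
exact: (@measurable_equator_point R n measurableT B mB).
Qed.

Let msnd (Q : 'M[R]_d) (C : set (V * V)) : measurable C ->
  measurable [set z : V * V | C (z.1, (z.2 : 'rV[R]_d) *m Q)].
Proof.
move=> mC; rewrite -[X in measurable X]setTI.
have mf : measurable_fun setT (fun z : V * V => (z.1, (z.2 : 'rV[R]_d) *m Q : V)).
  apply: measurable_fun_pair; first exact: measurable_fst.
  exact: (measurableT_comp (measurable_mulmxr Q) measurable_snd).
exact: mf.
Qed.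

(** Off the null polar axis the point is a unit vector. For invariance, by equivariance a rotation
    of the point amounts to rotating y by Q and, for each fixed y, x by some Q'; both preserve the
    product law. *)
Lemma random_equator_surface : is_surface_probability random_equator.
Proof.
have mS := @measurable_unit_sphere R d.
split.
  have mZ : measurable ([set x | lsubmx (x : 'rV[R]_d) = 0] : set V).
    exact: measurable_polar_axis.
  apply/eqP; rewrite eq_le; apply/andP; split; first exact: probability_le1.
  pose Zc : set V := ~` [set x | lsubmx (x : 'rV[R]_d) = 0].
  have Zc1 : sigma Zc = 1%E.
    by rewrite /Zc probability_setC// polar_axis_null// sube0.
  have <- : (sigma \x sigma)%E (Zc `*` setT) = 1%E.
    transitivity (sigma Zc * sigma setT)%E.
      by apply: product_measure1E => //; exact: measurableC.
    by rewrite Zc1 mul1e [LHS]probability_setT.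
  apply: le_measure; rewrite ?inE.
  - by apply: measurableX => //; exact: measurableC.
  - exact: mp.
  - by move=> [x y] [/= /eqP x0 _]; exact: sqn_equator_point.
move=> Q rQ B mB; have [QQ dQ] := rQ.
pose C := [set z : V * V | B (p z)].
pose E1 := [set z : V * V | B (p z *m Q)].
pose E2 := [set z : V * V | C (z.1, (z.2 : 'rV[R]_d) *m Q)].
have mC : measurable C by exact: mp.
have mE1 : measurable E1 by exact: mp (measurable_preimage_mulmxr Q mB).
have mE2 : measurable E2 by exact: msnd.
have mTS : measurable ([set: V] `*` S : set (V * V)) by exact: measurableX.
have TS1 : (sigma \x sigma)%E ([set: V] `*` S : set (V * V)) = 1%E.
  transitivity (sigma setT * sigma S)%E; first exact: product_measure1E.
  by rewrite hsigma.1 mule1 [LHS]probability_setT.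
have -> : pushforward random_equator (fun x : V => x *m Q : V) B
    = (sigma \x sigma)%E E1.
  by [].
have -> : random_equator B = (sigma \x sigma)%E C by [].
transitivity ((sigma \x sigma)%E E2); last first.
  apply: product_measure_xsection => x.
  have mx := measurable_xsection x mC.
  rewrite -(surface_rotation hsigma rQ mx); exact: erefl.
(* Equivariance is available for unit y only, so both events are first cut down to y on the
   sphere. *)
rewrite -(@probability1I _ _ R (sigma \x sigma)%E _ _ mTS mE1 TS1).
rewrite -(@probability1I _ _ R (sigma \x sigma)%E _ _ mTS mE2 TS1).
apply: product_measure_ysection; [exact: measurableI|exact: measurableI|move=> y].
have [Sy|nSy] := pselect (S y); last first.
  congr (sigma _); apply/seteqP; split => x; rewrite /ysection /= inE;
  by move=> [[_ /nSy]].
have [Q' rQ' pQ] := equator_point_equivariant QQ Sy.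
have my := measurable_ysection y (measurableI _ _ mTS mE2).
rewrite -(surface_rotation hsigma rQ' my); congr (sigma _).
apply/seteqP; split => x; rewrite /ysection /= !inE => -[_] /=.
  by rewrite /E1 /E2 /C /p /= pQ.
by rewrite /E1 /E2 /C /p /= pQ.
Qed.

(** The bound is used with T the reflection for y and u the equatorial direction of x. Applying W_i
    to u amounts to rotating x, so each event has the [random_equator] mass of B, which is sigma B
    by uniqueness. *)
Lemma equator_average (I : eqType) (s : seq I) (W : I -> 'M[R]_n.+1)
    (B : set V) (k : nat) :
  (forall i, i \in s -> is_rotation (W i)) -> measurable B ->
  (forall (T : 'M[R]_d) (u : 'rV[R]_n.+1),
    (\sum_(i <- s) `[< B (row_mx (u *m W i) 0 *m T) >] <= k)%N) ->
  ((size s)%:R%:E * sigma B <= k%:R%:E)%E.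
Proof.
move=> rW mB le_k.
pose C := [set z : V * V | B (p z)].
have mC : measurable C by exact: mp.
pose E i := [set z : V * V | B (row_mx (equator_dir (z.1 : 'rV[R]_d) *m W i) 0
                                *m householder (z.2 : 'rV[R]_d))].
have EE i : i \in s -> E i =
    [set z : V * V | C ((z.1 : 'rV[R]_d) *m equator_rotation (W i), z.2)].
  move=> si; have [WW _] := rW i si.
  by apply/seteqP; split => -[x y]; rewrite /E /C /p /= equator_point_rotation.
pose f i (z : V * V) : V * V := ((z.1 : 'rV[R]_d) *m equator_rotation (W i), z.2).
have mf i : measurable_fun setT (f i).
  apply: measurable_fun_pair; last exact: measurable_snd.
  exact: (measurableT_comp (measurable_mulmxr _) measurable_fst).
(* W i is known to be a rotation only for i in s; the empty set elsewhere makes every event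
   measurable. *)
pose E' i := if i \in s then E i else set0.
have mE i : measurable (E' i).
  rewrite /E'; case: ifP => // si; rewrite EE//.
  by rewrite -[X in measurable X]setTI; exact: mf.
have le_E z : (\sum_(i <- s) `[< E' i z >] <= k)%N.
  rewrite big_seq; under eq_bigr => i si do rewrite /E' si.
  by rewrite -big_seq; exact: le_k.
have := sum_probability_le (sigma \x sigma)%E mE le_E.
apply: le_trans; rewrite big_seq.
have eqE i : i \in s -> (sigma \x sigma)%E (E' i) = sigma B.
  move=> si; rewrite (surface_unique hsigma random_equator_surface mB).
  have := mE i; rewrite /E' si => mEi.
  apply: product_measure_ysection => // y.
  have my := measurable_ysection y mC.
  rewrite -(surface_rotation hsigma (equator_rotationP (rW i si).1) my).
  rewrite EE//.
rewrite (eq_bigr (fun=> sigma B)) => [|i /eqE//].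
by rewrite -big_seq sume_cst// measure_ge0.
Qed.

End RandomEquator.

(** * The bound in dimensions 4 and 5 *)

Lemma zero_sum_free_slice (R : realType) m n (A : set 'rV[R]_(m + n))
    (T : 'M[R]_(m + n)) : zero_sum_free A ->
  zero_sum_free [set v : 'rV[R]_m | A (row_mx v 0 *m T)].
Proof.
move=> zsf [x [y [z [Ax Ay Az s0]]]]; apply: zsf.
exists (row_mx x 0 *m T), (row_mx y 0 *m T), (row_mx z 0 *m T); split => //.
by rewrite -!mulmxDl !add_row_mx !addr0 s0 row_mx0 mul0mx.
Qed.

Lemma zero_sum_free_sub (R : realType) d (A B : set 'rV[R]_d) :
  B `<=` A -> zero_sum_free A -> zero_sum_free B.
Proof.
move=> BA zsf [x [y [z [/BA Ax /BA Ay /BA Az s0]]]].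
by apply: zsf; exists x, y, z.
Qed.

Lemma zero_sum_free_borel_bound (R : realType) (d : nat)
    (sigma : probability (borel_rV R d) R) (B : set (borel_rV R d)) :
  d = 4%N \/ d = 5%N -> is_surface_probability sigma -> measurable B ->
  zero_sum_free B -> (120%:R%:E * sigma B <= 71%:R%:E)%E.
Proof.
have rot g : g \in icosians -> is_rotation (qmx R g) by exact: qmx_rotation.
case=> d_eq; subst d => hsigma mB zsf; rewrite -size_icosians.
  apply: (rotation_average hsigma rot mB) => x.
  exact: icosian_orbit_bound.
apply: (@equator_average R 3 sigma hsigma _ _ _ B _ rot mB) => T u.
exact: (icosian_orbit_bound (@zero_sum_free_slice R 4 1 B T zsf)).
Qed.

Unset Implicit Arguments.
Set Strict Implicit.
Set Printing Implicit Defensive.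

Theorem theorem1p2 (R : realType) (d : nat) (hd : d = 4%N \/ d = 5%N)
    (sigma : probability (borel_rV R d) R)
    (hsigma : is_surface_probability sigma)
    (A : set 'rV[R]_d)
    (hAS : A `<=` unit_sphere R d)
    (hAm : completed_measurable sigma A)
    (hA : zero_sum_free A) :
  (completed_measure sigma A <= (71 / 120)%:E)%E.
Proof.
(* A Borel subset of A is again zero-sum-free, so inner approximation carries the Borel bound over
   to A. *)
apply/lee_addgt0Pr => e e0.
have [B [mB BA AB]] := completed_inner hAm e0.
apply: le_trans AB _; apply: leeD2r.
have fB := fin_num_measure sigma _ mB.
have := zero_sum_free_borel_bound hd hsigma mB (zero_sum_free_sub BA hA).
rewrite -(fineK fB) -EFinM !lee_fin => h.
by rewrite ler_pdivlMr// mulrC.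
Qed.
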